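(* There is a function $\varepsilon(n)$ with $\varepsilon(n)\to 0$ as $n\to\infty$ such that for every $n$ there exists an $n$-vertex graph $G$ with $$m_G(\log n) \le 2^{2^{(\log \log n)^{1/2+\varepsilon(n)}}}.$$
   Context: All logarithms are base $2$. For a graph $G$ and reals $m,r>0$ (not necessarily integers), $G$ is called $(m,r)$-locally Ramsey if every set of at least $m$ vertices of $G$ contains both a clique and an independent set of size at least $r$. $m_G(r)$ denotes the smallest $m$ for which $G$ is $(m,r)$-locally Ramsey, i.e. the smallest $m$ such that any $m$ vertices of $G$ contain both a clique and an independent set of size (at least) $r$. *)

(* Defs.v *)
From HB Require Import structures.
From mathcomp Require Import all_boot all_order all_algebra.
From mathcomp Require Import all_classical all_reals all_analysis.
Set Implicit Arguments. Unset Strict Implicit. Unset Printing Implicit Defensive.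
Import Order.TTheory GRing.Theory Num.Theory.
Local Open Scope ring_scope.

(* A graph on n vertices is a
   symmetric irreflexive relation e on 'I_n. *)

Section LocRamsey.
Variables (R : realType) (n : nat) (e : rel 'I_n).

Definition is_clique (K : {set 'I_n}) : bool :=
  [forall x in K, forall y in K, (x != y) ==> e x y].

Definition is_indep (K : {set 'I_n}) : bool :=
  [forall x in K, forall y in K, (x != y) ==> ~~ e x y].

Definition locally_ramsey (m r : R) : bool :=
  [forall S : {set 'I_n}, (m <= #|S|%:R) ==>
     ([exists K : {set 'I_n}, [&& K \subset S, is_clique K & r <= #|K|%:R]] &&
      [exists K : {set 'I_n}, [&& K \subset S, is_indep K & r <= #|K|%:R]])].

Lemma locally_ramsey_big (r : R) : exists m : nat, locally_ramsey m%:R r.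
Proof.
exists n.+1; apply/forallP => S; apply/implyP; rewrite ler_nat => h.
have := max_card S; rewrite card_ord => h2.
by have := leq_trans h h2; rewrite ltnn.
Qed.

(* m_G(r): the smallest m (sizes being integers, the smallest natural
   number m) such that G is (m,r)-locally Ramsey. *)
Definition mG (r : R) : nat := ex_minn (locally_ramsey_big r).

End LocRamsey.

Definition log2 {R : realType} (x : R) : R := ln x / ln 2.

(* Main.v *)
(* The graph is built by alternating two operations. Write r for the target size.
   Perturbing a graph on 2^L vertices, i.e. recolouring each pair at random with
   probability about 1/r^2, makes every set of c = O(L r^2) vertices contain both an
   edge and a non-edge, while every r-clique survives with probability at least 1/2, so
   that local Ramseyness with parameters (m, r) only degrades to (mc, r). Taking the
   K-th lexicographic power of the perturbed graph then raises the number of vertices to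
   the power K, but m only becomes (mc)^k (2c)^K as soon as r <= 2^k: a large set without
   an r-clique either has m nonempty fibres at some level, or it branches at least c
   times at k levels, each of which doubles the clique. Repeating this z times with
   K = 2^z, k = z^2 and r = 2^(z^2) gives 2^(2^(z^2)) vertices and
   log log m = O(z log z). *)
Require Import Defs.
From HB Require Import structures.
From mathcomp Require Import all_boot all_order all_algebra.
From mathcomp Require Import all_classical all_reals all_analysis.
From mathcomp Require Import zify ring lra.

(* Inside this section the names shadowed by [classical_sets] denote the lemmas on
   finite sets again. *)
Section FiniteGraphs.
Import boot.fintype boot.finset.

(** * Monochromatic sets, and subsets avoiding a family of pairs *)

Definition mono {T : finType} (e : rel T) (b : bool) (K : {set T}) : bool :=
  [forall x in K, forall y in K, (x != y) ==> (e x y == b)].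

Lemma monoP {T : finType} (e : rel T) (b : bool) (K : {set T}) :
  reflect {in K &, forall x y, x != y -> e x y = b} (mono e b K).
Proof.
apply: (iffP idP) => [h x y xK yK xy|h].
  by move/forall_inP/(_ x xK)/forall_inP/(_ y yK)/implyP/(_ xy)/eqP : h.
apply/forall_inP => x xK; apply/forall_inP => y yK; apply/implyP => xy.
exact/eqP/h.
Qed.

Lemma mono_sub {T : finType} (e : rel T) (b : bool) (K' K : {set T}) :
  K' \subset K -> mono e b K -> mono e b K'.
Proof.
move=> /subsetP sK /monoP h; apply/monoP => x y xK yK; exact: h (sK _ xK) (sK _ yK).
Qed.

(** Integer form of local Ramseyness, treating cliques ([b = true]) and independent sets
    ([b = false]) alike; any finite vertex type is allowed, so that products fit. *)
Definition ramsey {T : finType} (e : rel T) (m r : nat) : Prop :=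
  forall (b : bool) (S : {set T}), m <= #|S| ->
    exists2 K : {set T}, K \subset S & mono e b K && (r <= #|K|).

Definition pairs {T : finType} (A : {set T}) : {set {set T}} :=
  [set B : {set T} | B \subset A & #|B| == 2].

Lemma subset_card {T : finType} (m : nat) (S : {set T}) :
  m <= #|S| -> exists2 A : {set T}, A \subset S & #|A| = m.
Proof.
move=> mS; have : 0 < #|[set A : {set T} | A \subset S & #|A| == m]|.
  by rewrite cards_draws bin_gt0.
by case/card_gt0P => A; rewrite inE => /andP[AS /eqP Am]; exists A.
Qed.

(* Peel off maximal [Z]-free subsets of [S]: each has fewer than [m] vertices
   and every remaining vertex sends a pair of [Z] into it. *)
Lemma free_subset {T : finType} (Z : {set {set T}}) (m j : nat) (S : {set T}) :
  #|Z :&: pairs S| < j * (#|S| - j * m) ->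
  exists2 A : {set T}, A \subset S & #|A| = m /\ [disjoint Z & pairs A].
Proof.
elim: j S => [|j IH] S; first by rewrite mul0n.
move=> ZS.
pose fr := [pred A : {set T} | (A \subset S) && [disjoint Z & pairs A]].
have [I /maxsetP[/andP[IS dI] maxI] _] : {I | maxset fr I & set0 \subset I}.
  apply: maxset_exists; rewrite /= sub0set /= disjoint_sym.
  rewrite disjoints_subset; apply/subsetP => B; rewrite inE subset0.
  by case/andP => /eqP->; rewrite cards0.
have [mI|Im] := leqP m #|I|.
  have [A AI Am] := subset_card m I mI.
  exists A; first exact: subset_trans AI IS.
  split=> //; rewrite disjoint_sym; apply: disjointWl; last by rewrite disjoint_sym; exact: dI.
  apply/subsetP => B; rewrite !inE => /andP[BA ->]; rewrite andbT.
  exact: subset_trans BA AI.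
have nb v : v \in S :\: I -> exists2 u, u \in I & [set u; v] \in Z.
  rewrite inE => /andP[vI vS].
  have : ~~ fr (v |: I).
    apply/negP => h; have /setP/(_ v) := maxI _ h (subsetUr _ _).
    by rewrite !inE eqxx (negbTE vI).
  rewrite /= subUset sub1set vS IS /= -setI_eq0 => /set0Pn[B].
  rewrite !inE => /andP[BZ /andP[BI /eqP B2]].
  have vB : v \in B.
    apply: contraT => vB; have : B \in Z :&: pairs I.
      rewrite !inE BZ B2 eqxx andbT /=; apply/subsetP => x xB.
      have := subsetP BI x xB; rewrite !inE; case: eqP => // xv.
      by move: xB vB; rewrite xv => ->.
    by move: dI; rewrite -setI_eq0 => /eqP ->; rewrite inE.
  have /cards1P[u Bu] : #|B :\ v| == 1.
    by move: B2; rewrite (cardsD1 v B) vB add1n => -[->].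
  have uB : u \in B :\ v by rewrite Bu inE.
  move: (uB); rewrite !inE => /andP[uv uB'].
  exists u.
    by have := subsetP BI u uB'; rewrite !inE (negbTE uv).
  suff -> : [set u; v] = B by [].
  by rewrite -(setD1K vB) Bu setUC.
pose g v := if v \in S :\: I then odflt v [pick u | (u \in I) && ([set u; v] \in Z)] else v.
have gP v : v \in S :\: I -> (g v \in I) && ([set g v; v] \in Z).
  move=> vSI; rewrite /g vSI; case: pickP => [u //|h].
  by have [u uI uZ] := nb v vSI; have := h u; rewrite uI uZ.
(* Each of these pairs has exactly one end outside [I], which determines it. *)
have gI : {in S :\: I &, injective (fun v => [set g v; v])}.
  move=> v w vS wS /= E.
  have /andP[gv _] := gP v vS; have /andP[gw _] := gP w wS.
  have : v \in [set g w; w] by rewrite -E !inE eqxx orbT.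
  rewrite !inE => /orP[/eqP vg|/eqP //].
  by move: vS; rewrite vg inE gw.
have [A AS [Am dA]] : exists2 A : {set T}, A \subset S :\: I &
    #|A| = m /\ [disjoint Z & pairs A].
  apply: IH.
  have cSI : #|S :\: I| = #|S| - #|I| by rewrite cardsD (setIidPr IS).
  (* Removing [I] loses one pair of [Z] per remaining vertex, while more than [#|S| - m] vertices
     remain; the induction on [j] needs just this. *)
  have le : #|Z :&: pairs (S :\: I)| + #|S :\: I| <= #|Z :&: pairs S|.
    rewrite -(card_in_imset gI).
    set X := Z :&: pairs (S :\: I); set Y := imset _ _.
    have XY : X :&: Y = set0.
      apply/setP => B; rewrite !inE; apply/negbTE/negP.
      case/andP=> /andP[_ /andP[BS _]] /imsetP[v vS Bv].
      have /andP[gv _] := gP v vS.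
      have : g v \in B by rewrite Bv !inE eqxx.
      by move=> /(subsetP BS); rewrite inE gv.
    rewrite -cardsUI XY cards0 addn0.
    apply: subset_leq_card; rewrite subUset; apply/andP; split.
      apply/subsetP => B; rewrite !inE => /andP[-> /andP[BS ->]]; rewrite andbT /=.
      exact: subset_trans BS (subsetDl _ _).
    apply/subsetP => B /imsetP[v vS ->]; have /andP[gv gZ] := gP v vS.
    move: vS; rewrite !inE gZ /= => /andP[vI vS].
    rewrite subUset !sub1set vS (subsetP IS _ gv) /= cards2.
    by rewrite (_ : g v != v) //; apply: contraNneq vI => <-.
  nia.
by exists A => //; exact: subset_trans AS (subsetDl _ _).
Qed.

(** * Random recolourings, with probabilities as counts cleared of denominators *)

Lemma card_ffun_forall {I J : finType} (X : {set I}) (t : pred J) :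
  #|[set w : {ffun I -> J} | [forall x in X, t (w x)]]| * #|J| ^ #|X| =
  #|t| ^ #|X| * #|J| ^ #|I|.
Proof.
have -> : #|[set w : {ffun I -> J} | [forall x in X, t (w x)]]| =
    #|t| ^ #|X| * #|J| ^ #|~: X|.
  pose F x := if x \in X then t else predT.
  rewrite (_ : #|_| = #|family F|); last first.
    rewrite cardsE; apply: eq_card => w; rewrite unfold_in; apply/forall_inP/familyP => h x.
      by rewrite /F; case: ifP => [/h|].
    by move=> xX; have := h x; rewrite /F xX.
  rewrite card_family foldrE big_image /= (bigID (mem X)) /=; congr (_ * _).
    rewrite (eq_bigr (fun=> #|t|)) ?prod_nat_const // => x xX.
    by rewrite /F xX.
  rewrite (eq_bigr (fun=> #|J|)) => [|x /negbTE xX]; last first.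
    by rewrite /F xX; apply: eq_card.
  by rewrite prod_nat_const; congr (_ ^ _); apply: eq_card => x; rewrite !inE.
by rewrite -mulnA -expnD addnC cardsC.
Qed.

(** This is (1 - 1/(d+1))^(d+1) <= 1/2, by Bernoulli's inequality with exponent [d.+1]. *)
Lemma pred_expn_double (d : nat) : 2 * d ^ d.+1 <= d.+1 ^ d.+1.
Proof.
have bern n : d ^ n * (d + n) <= d * d.+1 ^ n.
  elim: n => [|n IH]; first by rewrite !expn0 addn0 mul1n muln1.
  have : d ^ n * (d + n) * d.+1 <= d * d.+1 ^ n * d.+1 by rewrite leq_mul2r IH orbT.
  rewrite !expnSr; nia.
case: d bern => [//|d] /(_ d.+2) h.
rewrite -(leq_pmul2l (ltn0Sn d)); apply: leq_trans h; nia.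
Qed.

Lemma card_pairs {T : finType} (A : {set T}) : #|pairs A| = 'C(#|A|, 2).
Proof. exact: cards_draws. Qed.

Lemma card_bigcup_le {I W : finType} (P : pred I) (F : I -> {set W}) :
  #|\bigcup_(i | P i) F i| <= \sum_(i | P i) #|F i|.
Proof.
elim/big_rec2: _ => [|i n U _ h]; first by rewrite cards0.
by apply: leq_trans (leq_card_setU _ _) _; rewrite leq_add2l.
Qed.

Lemma bin_leq_expn (n k : nat) : 'C(n, k) <= n ^ k.
Proof.
apply: (@leq_trans (n ^_ k)); first by rewrite -bin_ffact leq_pmulr ?fact_gt0.
elim: k => // k IH; rewrite ffactnSr expnSr; apply: leq_mul IH _; exact: leq_subr.
Qed.

(** A uniform element has first coordinate 0 with probability 1/q, which triggers a recolouring by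
    the second; each colour is thus forced with probability 1/(2q). *)
Definition noise (q : nat) : finType := ('I_q * bool)%type.

(** Indexing the noise by vertex sets makes the recolouring of a pair symmetric by construction. *)
Definition perturb {T : finType} {q : nat} (e : rel T)
    (w : {ffun {set T} -> noise q}) : rel T :=
  fun x y => (x != y) &&
    (if (w [set x; y]).1 == 0 :> nat then (w [set x; y]).2 else e x y).

Definition forced {q : nat} (b : bool) (p : noise q) : bool :=
  (p.1 == 0 :> nat) && (p.2 == b).

Lemma card_noise (q : nat) : #|noise q| = 2 * q.
Proof. by rewrite card_prod card_ord card_bool mulnC. Qed.

Lemma card_forced (q : nat) (b : bool) : 0 < q -> #|[pred p : noise q | forced b p]| = 1.
Proof.
move=> q0; rewrite (eq_card (_ : _ =i pred1 (Ordinal q0, b))) ?card1 //.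
Qed.

Definition unforced_on {T : finType} (q : nat) (b : bool) (A : {set T}) :
    {set {ffun {set T} -> noise q}} :=
  [set w : {ffun {set T} -> noise q} | [forall B in pairs A, ~~ forced b (w B)]].

(** Pairs escape independently with probability 1 - 1/(2q), so each of [E] disjoint blocks of
    [2 * q] pairs halves the proportion. *)
Lemma card_unforced_on {T : finType} (q E : nat) (b : bool) (A : {set T}) :
  0 < q -> 2 * q * E <= 'C(#|A|, 2) ->
  #|unforced_on q b A| * 2 ^ E <= #|{ffun {set T} -> noise q}|.
Proof.
move=> q0 hE; have := card_ffun_forall (pairs A) [pred p : noise q | ~~ forced b p].
have ct : #|[pred p : noise q | ~~ forced b p]| = (2 * q).-1.
  have := cardC [pred p : noise q | forced b p].
  by rewrite card_forced // card_noise add1n => <-.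
rewrite ct -card_ffun card_noise card_pairs => h.
rewrite -(leq_pmul2r (_ : 0 < (2 * q) ^ 'C(#|A|, 2))); last first.
  by rewrite expn_gt0 muln_gt0 q0.
set F := #|{ffun _ -> _}| in h *.
rewrite mulnAC h -mulnA [F * _]mulnC mulnA mulnC leq_mul2l; apply/orP; right.
have D0 : 0 < 2 * q by rewrite muln_gt0.
move: D0 hE; clear; move: (2 * q) => D D0 hE.
have mono_exp x y n : x <= y -> x ^ n <= y ^ n by case: n => // n; rewrite leq_exp2r.
rewrite -(subnK hE) !expnD !expnM -mulnA.
apply: leq_mul; first by apply: mono_exp; exact: leq_pred.
rewrite -expnMn; apply: mono_exp; rewrite mulnC.
by have := pred_expn_double D.-1; rewrite prednK.
Qed.

(** The bad event for [r]-sets: when it fails, some set of colour [b] in [S] has no pair forced to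
    the other colour, hence survives. *)
Definition spoiled_on {T : finType} (q r : nat) (e : rel T) (b : bool) (S : {set T}) :
    {set {ffun {set T} -> noise q}} :=
  [set w : {ffun {set T} -> noise q} | [forall K : {set T},
    [&& K \subset S, mono e b K & r <= #|K|] ==>
      [exists B in pairs K, forced (~~ b) (w B)]]].

(* Branching: [Z] is a set of pairs known to be forced to the wrong colour. While it
   is small, some [m]-subset of [S], hence some [r]-set of colour [b], avoids it, and
   one of the at most [r ^ 2] pairs of that [r]-set must also be forced. *)
Lemma card_spoiled_on {T : finType} (q r m j M : nat) (e : rel T) (b : bool) (S : {set T}) :
  0 < q -> ramsey e m r -> M <= j * (#|S| - j * m) ->
  #|spoiled_on q r e b S| * (2 * q) ^ M <= (r ^ 2) ^ M * #|{ffun {set T} -> noise q}|.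
Proof.
move=> q0 Rm hM.
(* [i] counts the forced pairs still to be found: each costs a factor [r ^ 2] for its choice and
   gains [2 * q] for being forced. *)
have branch i (Z : {set {set T}}) : #|Z| + i = M ->
  #|[set w in spoiled_on q r e b S | [forall B in Z, forced (~~ b) (w B)]]|
    * (2 * q) ^ M <= (r ^ 2) ^ i * #|{ffun {set T} -> noise q}|.
  elim: i Z => [|i IH] Z ZM.
    rewrite addn0 in ZM; rewrite expn0 mul1n card_ffun.
    have := card_ffun_forall Z [pred p : noise q | forced (~~ b) p].
    rewrite card_forced // exp1n mul1n ZM card_noise => <-.
    rewrite leq_mul2r; apply/orP; right; apply: subset_leq_card.
    by apply/subsetP => w; rewrite !inE => /andP[].
  have [A AS [Am dA]] : exists2 A : {set T}, A \subset S & #|A| = m /\ [disjoint Z & pairs A].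
    apply: (free_subset Z m j); apply: leq_trans hM.
    apply: leq_ltn_trans (subset_leq_card (subsetIl _ _)) _.
    by rewrite -ZM addnS ltnS leq_addr.
  have [K0 K0A /andP[mK0 rK0]] : exists2 K : {set T}, K \subset A & mono e b K && (r <= #|K|).
    by apply: Rm; rewrite Am.
  have [K KK0 Kr] := subset_card r K0 rK0.
  have KA := subset_trans KK0 K0A.
  set U := [set w in _ | _].
  have UK : U \subset \bigcup_(p in pairs K) [set w in spoiled_on q r e b S |
      [forall B in p |: Z, forced (~~ b) (w B)]].
    apply/subsetP => w; rewrite inE => /andP[wS /forall_inP wZ].
    move: (wS); rewrite inE => /forallP/(_ K).
    rewrite (subset_trans KA AS) (mono_sub _ _ _ _ KK0 mK0) Kr leqnn /=.
    move=> /existsP[p /andP[pK fp]]; apply/bigcupP; exists p => //.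
    rewrite inE wS /=; apply/forall_inP => B; rewrite !inE => /orP[/eqP->//|]; exact: wZ.
  apply: (@leq_trans (\sum_(p in pairs K) (r ^ 2) ^ i * #|{ffun {set T} -> noise q}|)).
    apply: (@leq_trans ((\sum_(p in pairs K) #|[set w in spoiled_on q r e b S |
      [forall B in p |: Z, forced (~~ b) (w B)]]|) * (2 * q) ^ M)).
      rewrite leq_mul2r; apply/orP; right.
      exact: leq_trans (subset_leq_card UK) (card_bigcup_le _ _).
    rewrite big_distrl /=; apply: leq_sum => p pK; apply: IH.
    rewrite cardsU1 (_ : p \notin Z) ?add1n ?addSnnS //.
    apply/negP => pZ; have : p \in Z :&: pairs A.
      rewrite inE pZ inE; move: pK; rewrite inE => /andP[pK ->].
      by rewrite (subset_trans pK KA).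
    by move: dA; rewrite -setI_eq0 => /eqP ->; rewrite inE.
  rewrite sum_nat_const card_pairs Kr [(r ^ 2) ^ i.+1]expnS -mulnA leq_mul2r bin_leq_expn orbT //.
have := branch M set0; rewrite cards0 => /(_ erefl).
rewrite (_ : [set w in _ | _] = spoiled_on q r e b S) //.
by apply/setP => w; rewrite inE andb_idr // => _; apply/forall_inP => B; rewrite inE.
Qed.

(** At most [2 * #|T| ^ s <= 2 ^ (s * L + 1)] events are united, so their total probability is at
    most 1/4. *)
Lemma union_bound {T W : finType} (F : bool -> {set T} -> {set W}) (s L : nat) :
  #|T| <= 2 ^ L ->
  (forall (b : bool) (A : {set T}), #|A| = s -> #|F b A| * 2 ^ (s * L + 3) <= #|W|) ->
  #|\bigcup_(p : bool * {set T} | #|p.2| == s) F p.1 p.2| * 4 <= #|W|.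
Proof.
move=> TL hF.
rewrite -(leq_pmul2r (_ : 0 < 2 ^ (s * L + 1))) ?expn_gt0 //.
apply: (@leq_trans (\sum_(p : bool * {set T} | #|p.2| == s) #|W|)).
  rewrite -mulnA (_ : 4 * 2 ^ (s * L + 1) = 2 ^ (s * L + 3)); last first.
    by rewrite (_ : 4 = 2 ^ 2) // -expnD; congr (_ ^ _); lia.
  apply: (@leq_trans ((\sum_(p : bool * {set T} | #|p.2| == s) #|F p.1 p.2|) *
      2 ^ (s * L + 3))).
    rewrite leq_mul2r; apply/orP; right; exact: card_bigcup_le.
  by rewrite big_distrl /=; apply: leq_sum => p /eqP; apply: hF.
rewrite sum_nat_const mulnC leq_mul2l; apply/orP; right.
rewrite (eq_card (_ : _ =i [predX predT & [pred A : {set T} | #|A| == s]])); last first.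
  by move=> -[b A]; rewrite !inE.
rewrite cardX card_bool -cardsE card_draws addn1 expnS leq_mul2l /=.
apply: leq_trans (bin_leq_expn _ _) _; rewrite mulnC expnM.
by case: (s) => // n; rewrite leq_exp2r.
Qed.

(** The two families of bad events have probability at most 1/4 each, so some recolouring avoids
    both. *)
Lemma exists_perturb {T : finType} (e : rel T) (m r L c : nat) :
  symmetric e -> irreflexive e -> #|T| <= 2 ^ L -> ramsey e m r ->
  0 < m -> 0 < r -> c = 4 * (L + 3) * r ^ 2 + 2 ->
  exists e' : rel T, [/\ symmetric e', irreflexive e', ramsey e' c 2 & ramsey e' (m * c) r].
Proof.
(* With this [q], the branching ratio r^2/(2q) is exactly 1/2. *)
move=> es ei TL Rm m0 r0 cE; pose q := r ^ 2.
have q0 : 0 < q by rewrite expn_gt0 r0.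
have c0 : 0 < c by rewrite cE addn2.
have h1 : #|\bigcup_(p : bool * {set T} | #|p.2| == c) unforced_on q p.1 p.2| * 4 <=
    #|{ffun {set T} -> noise q}|.
  apply: (union_bound (unforced_on q) c L TL) => b A Ac.
  apply: card_unforced_on => //; rewrite Ac.
  have : 'C(c, 2) * 2 = c * c.-1 by rewrite -[2 in LHS]/(2`!) bin_ffact ffactnS ffactn1.
  (* The choice of [c] gives [c.-1 >= 4 * (L + 3) * q], and [c * (L + 3) >= c * L + 3]. *)
  have : 2 * (2 * q * (c * L + 3)) <= c * c.-1.
    rewrite {3}cE addn2 /= -/q; nia.
  nia.
have h2 : #|\bigcup_(p : bool * {set T} | #|p.2| == m * c) spoiled_on q r e p.1 p.2| * 4 <=
    #|{ffun {set T} -> noise q}|.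
  apply: (union_bound (spoiled_on q r e) (m * c) L TL) => b A Ac.
  (* For [j = 2 * (L + 3)] one has [2 * j <= c], so [j * (m * c - j * m)] is at least
     [(L + 3) * m * c], enough for [m * c * L + 3]. *)
  have := card_spoiled_on q r m (2 * (L + 3)) (m * c * L + 3) e b A q0 Rm.
  rewrite Ac expnMn -/q => h.
  rewrite -(leq_pmul2r (_ : 0 < q ^ (m * c * L + 3))) ?expn_gt0 ?r0 //.
  rewrite -mulnA [X in _ <= X]mulnC; apply: h.
  have : 4 * (L + 3) <= c by rewrite cE -/q; nia.
  nia.
move: h1 h2; set U1 := \bigcup_(p | _) _; set U2 := \bigcup_(p | _) _ => h1 h2.
have [w] : exists w, w \notin U1 :|: U2.
  apply/existsP; rewrite -negb_forall; apply/negP => /forallP U12.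
  have : #|{ffun {set T} -> noise q}| <= #|U1| + #|U2|.
    apply: leq_trans (leq_card_setU U1 U2); apply: subset_leq_card.
    by apply/subsetP => w _.
  have : 0 < #|{ffun {set T} -> noise q}|.
    by rewrite card_ffun card_noise expn_gt0 muln_gt0 q0.
  lia.
rewrite inE negb_or => /andP[w1 w2].
exists (perturb e w); split.
- by move=> x y; rewrite /perturb setUC eq_sym es.
- by move=> x; rewrite /perturb eqxx.
- move=> b S /subset_card[A AS Ac].
  have : w \notin unforced_on q b A.
    by apply: contra w1 => h; apply/bigcupP; exists (b, A); rewrite //= Ac.
  rewrite inE negb_forall_in => /existsP[B /andP[BA]]; rewrite negbK => fB.
  move: BA; rewrite inE => /andP[BA /cards2P[x [y [xy BE]]]].
  exists B; first exact: subset_trans AS.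
  rewrite {2}BE cards2 xy andbT; apply/monoP => u v uB vB uv.
  have BE' : B = [set u; v].
    apply/esym/eqP; rewrite eqEcard subUset !sub1set uB vB cards2 uv /=.
    by rewrite BE cards2 xy.
  by move: fB; rewrite /perturb uv BE' => /andP[-> /eqP].
- move=> b S /subset_card[A AS Ac].
  have : w \notin spoiled_on q r e b A.
    by apply: contra w2 => h; apply/bigcupP; exists (b, A); rewrite //= Ac.
  rewrite inE negb_forall => /existsP[K]; rewrite negb_imply negb_exists_in.
  move=> /andP[/and3P[KA /monoP mK rK] /forall_inP hK].
  exists K; first exact: subset_trans AS.
  rewrite rK andbT; apply/monoP => u v uK vK uv; rewrite /perturb uv /=.
  have : ~~ forced (~~ b) (w [set u; v]).
    by apply: hK; rewrite inE subUset !sub1set uK vK cards2 uv.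
  rewrite /forced; case: eqP => _ /=; last by rewrite mK.
  by case: (w _).2; case: (b).
Qed.

(** * Lexicographic products and powers *)

Definition lexprod {T1 T2 : finType} (e1 : rel T1) (e2 : rel T2) : rel (T1 * T2) :=
  fun p q => if p.1 == q.1 then e2 p.2 q.2 else e1 p.1 q.1.

Lemma mono_lexprod {T1 T2 : finType} (e1 : rel T1) (e2 : rel T2) (b : bool)
    (A : {set T1}) (B : T1 -> {set T2}) :
  mono e1 b A -> (forall u, u \in A -> mono e2 b (B u)) ->
  mono (lexprod e1 e2) b [set p | (p.1 \in A) && (p.2 \in B p.1)].
Proof.
move=> /monoP mA mB; apply/monoP => -[u x] [v y]; rewrite !inE /= /lexprod /=.
move=> /andP[uA xB] /andP[vA yB]; case: (eqVneq u v) => [uv|uv _]; last exact: mA.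
move: vA yB; rewrite -uv => _ yB neq; have /monoP := mB u uA; apply=> //.
by apply: contraNneq neq => ->.
Qed.

Lemma card_fibers {T1 T2 : finType} (A : {set T1}) (B : T1 -> {set T2}) :
  #|[set p | (p.1 \in A) && (p.2 \in B p.1)]| = \sum_(u in A) #|B u|.
Proof.
rewrite -sum1_card (eq_bigl (fun p => (p.1 \in A) && (p.2 \in B p.1))); last first.
  by move=> p; rewrite inE.
rewrite -(pair_big_dep (mem A) (fun u x => x \in B u) (fun _ _ => 1)) /=.
by apply: eq_bigr => u _; rewrite sum1_card.
Qed.

(* A set with no monochromatic set of size [minn r (2 ^ k)] has fewer than [m]
   nonempty fibres over the first factor, and of these fewer than [a] attain the
   bound for [k - 1], since two such fibres joined by an edge double the size. *)
Lemma ramsey_lexprod {T1 T2 : finType} (e1 : rel T1) (e2 : rel T2) (a m r N : nat) :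
  0 < a -> 1 < m -> ramsey e1 a 2 -> ramsey e1 m r ->
  (forall k, ramsey e2 (m ^ k * N) (minn r (2 ^ k))) -> 0 < N ->
  forall k, ramsey (lexprod e1 e2) (m ^ k * (2 * a * N)) (minn r (2 ^ k)).
Proof.
move=> a0 m1 Ra Rm IH N0 k b S hS.
pose B u := [set x | (u, x) \in S].
have sub (A : {set T1}) (C : T1 -> {set T2}) : (forall u, u \in A -> C u \subset B u) ->
    [set p | (p.1 \in A) && (p.2 \in C p.1)] \subset S.
  move=> h; apply/subsetP => -[u x]; rewrite inE /= => /andP[uA].
  by move/(subsetP (h u uA)); rewrite inE.
have cS : #|S| = \sum_(u in [set u | B u != set0]) #|B u|.
  rewrite -card_fibers; apply: eq_card => -[u x]; rewrite !inE /= andb_idl // => uxS.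
  by apply/set0Pn; exists x; rewrite inE.
case: k hS => [|k] hS.
  have [p pS] : exists p, p \in S.
    by apply/card_gt0P; apply: leq_trans hS; rewrite mul1n !muln_gt0 a0 N0.
  exists [set p]; first by rewrite sub1set.
  rewrite cards1 geq_minr andbT; apply/monoP => x y.
  by rewrite !inE => /eqP-> /eqP->; rewrite eqxx.
(* A single heavy fibre is settled inside the second factor. *)
have [/existsP[u hu]|/existsPn light] := boolP [exists u, m ^ k.+1 * N <= #|B u|].
  have [K KB /andP[mK rK]] := IH k.+1 b _ hu.
  exists [set p | (p.1 \in [set u]) && (p.2 \in K)].
    by apply: (sub [set u] (fun=> K)) => v; rewrite inE => /eqP->.
  rewrite (mono_lexprod e1 e2 b [set u] (fun=> K)) //=.
    by rewrite (card_fibers [set u] (fun=> K)) big_set1.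
  by apply/monoP => x y; rewrite !inE => /eqP-> /eqP->; rewrite eqxx.
pose X := [set u | m ^ k * N <= #|B u|]; pose Y := [set u | B u != set0].
(* Two fibres of [X] joined in colour [b] each contain a set for [k]; the union has twice the
   size. *)
have [aX|Xa] := leqP a #|X|.
  have [E EX /andP[mE E2]] := Ra b X aX.
  have hK u : exists K : {set T2}, u \in E ->
      [&& K \subset B u, mono e2 b K & minn r (2 ^ k) <= #|K|].
    case: (boolP (u \in E)) => [uE|_]; last by exists set0.
    have := subsetP EX u uE; rewrite inE => /(IH k b)[K KB h].
    by exists K; rewrite KB.
  have [C hC] := boolp.choice hK.
  exists [set p | (p.1 \in E) && (p.2 \in C p.1)].
    by apply: sub => u /hC /and3P[].
  rewrite mono_lexprod //=; last by move=> u /hC /and3P[].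
  rewrite card_fibers; apply: (@leq_trans (\sum_(u in E) minn r (2 ^ k))).
    rewrite sum_nat_const expnS; nia.
  by apply: leq_sum => u /hC /and3P[].
(* One vertex from each fibre over an [r]-set of colour [b] is enough. *)
have [mY|Ym] := leqP m #|Y|.
  have [E EY /andP[mE rE]] := Rm b Y mY.
  have hK u : exists x, u \in E -> x \in B u.
    case: (boolP (u \in E)) => [uE|_].
      by have := subsetP EY u uE; rewrite inE => /set0Pn[x xB]; exists x.
    have /card_gt0P[p _] : 0 < #|S|.
      by apply: leq_trans hS; rewrite !muln_gt0 expn_gt0 a0 N0 (ltnW m1).
    by exists p.2.
  have [f hf] := boolp.choice hK.
  exists [set p | (p.1 \in E) && (p.2 \in [set f p.1])].
    by apply: (sub E (fun u => [set f u])) => u uE; rewrite sub1set; exact: hf.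
  rewrite (mono_lexprod e1 e2 b E (fun u => [set f u])) //=; last first.
    by move=> u _; apply/monoP => x y; rewrite !inE => /eqP-> /eqP->; rewrite eqxx.
  rewrite (card_fibers E (fun u => [set f u])).
  rewrite (eq_bigr (fun=> 1)) ?sum1_card; last by move=> u _; rewrite cards1.
  by rewrite geq_min rE.
(* With [q = m ^ k.+1 * N], the fibres of [X] hold at most [a.-1 * q] vertices and the others at
   most [q]: together [a * q], against the assumed [2 * a * q]. *)
exfalso; move: hS; rewrite leqNgt => /negP; apply; rewrite cS.
rewrite (bigID (mem X)) /=.
have h1 : \sum_(u in Y | u \in X) #|B u| <= #|X| * (m ^ k.+1 * N).
  rewrite -sum_nat_const; apply: (@leq_trans (\sum_(u in X) #|B u|)).
    rewrite [leqRHS](bigID (mem Y)) /=.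
    rewrite [X in X <= _](eq_bigl (fun u => (u \in X) && (u \in Y))) ?leq_addr // => u.
    by rewrite andbC.
  by apply: leq_sum => u _; have := light u; rewrite -ltnNge => /ltnW.
have h2 : \sum_(u in Y | u \notin X) #|B u| <= #|Y| * (m ^ k * N).
  rewrite -sum_nat_const; apply: (@leq_trans (\sum_(u in Y | u \notin X) m ^ k * N)).
    by apply: leq_sum => u /andP[_]; rewrite inE -ltnNge => /ltnW.
  by rewrite [leqRHS](bigID (mem X)) /= leq_addl.
have p0 : 0 < m ^ k * N by rewrite muln_gt0 expn_gt0 (ltnW m1).
move: h1 h2; rewrite expnS => h1 h2; move: (leq_add h1 h2).
set s := _ + _; move=> hs; apply: leq_ltn_trans hs _.
move: p0 Xa Ym; set p := m ^ k * N => p0 Xa Ym.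
have -> : m * m ^ k * N = m * p by rewrite mulnA.
have -> : m * m ^ k * (2 * a * N) = 2 * a * (m * p).
  by rewrite /p mulnCA -!mulnA; congr (_ * _); rewrite !mulnA [a * _]mulnC -!mulnA [a * _]mulnCA.
have hX : #|X| * (m * p) <= a.-1 * (m * p) by rewrite leq_mul2r -ltnS prednK ?Xa ?orbT.
have hY : #|Y| * p <= m * p by rewrite leq_mul2r (ltnW Ym) orbT.
have q0 : 0 < m * p by rewrite muln_gt0 (ltnW m1).
apply: leq_ltn_trans (leq_add hX hY) _; move: q0; set q := m * p => q0.
rewrite -mulSnr prednK // -mulnA mul2n -addnn -[X in X < _]addn0 ltn_add2l.
by rewrite muln_gt0 a0.
Qed.

(** Each further factor costs only [2 * a] while [m ^ k] stays fixed. The induction carries all [k]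
    at once because the product step uses consecutive values of [k]. *)
Lemma lexpow {T : finType} (e : rel T) (a m r K : nat) :
  symmetric e -> irreflexive e -> 0 < a -> 1 < m -> ramsey e a 2 -> ramsey e m r ->
  exists (T' : finType) (e' : rel T'), [/\ symmetric e', irreflexive e',
    #|T'| = #|T| ^ K & forall k, ramsey e' (m ^ k * (2 * a) ^ K) (minn r (2 ^ k))].
Proof.
move=> es ei a0 m1 Ra Rm; elim: K => [|K [T' [e' [es' ei' cT' IH]]]].
  exists unit, (fun _ _ => false); split=> //; first by rewrite card_unit.
  move=> k b S; rewrite muln1 => hS.
  case: k hS => [|k] hS; last first.
    exfalso; have := leq_trans hS (max_card _); rewrite card_unit leqNgt.
    by rewrite -(expn0 m) ltn_exp2l.
  exists S => //; rewrite (leq_trans (geq_minr _ _) hS) andbT.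
  by apply/monoP => -[] [].
exists (T * T')%type, (lexprod e e'); split.
- by move=> [u x] [v y]; rewrite /lexprod /= eq_sym es es'.
- by move=> [u x]; rewrite /lexprod /= eqxx ei'.
- by rewrite card_prod cT' expnS.
- rewrite expnS; apply: ramsey_lexprod => //.
  by rewrite expn_gt0 muln_gt0 a0.
Qed.

(** * Alternating perturbations and powers *)

Lemma ramsey_weaken {T : finType} (e : rel T) (m m' r : nat) :
  m <= m' -> ramsey e m r -> ramsey e m' r.
Proof. by move=> mm' Rm b S hS; apply: Rm; exact: leq_trans hS. Qed.

(** [L] bounds every [K ^ i] that occurs, so one [c] serves all rounds. A round sends the exponent
    [l] to at most [(l + b) * k + b * K <= 3 * k * l], since [b * K <= l]. *)
Lemma iterate_perturb_lexpow (L r c b k K i : nat) :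
  c = 4 * (L + 3) * r ^ 2 + 2 -> 2 * c <= 2 ^ b -> 0 < r -> r <= 2 ^ k ->
  0 < k -> 0 < K -> K ^ i <= L ->
  exists (T : finType) (e : rel T), [/\ symmetric e, irreflexive e,
    #|T| = 2 ^ (K ^ i) & ramsey e (2 ^ (b * K * (3 * k) ^ i)) r].
Proof.
move=> cE cb r0 rk k0 K0.
have b2 : 2 <= b by rewrite -(@leq_exp2l 2) //; apply: leq_trans cb; rewrite cE; lia.
elim: i => [|i IH] KL.
  (* Two vertices suffice to start: the claim is vacuous because [2 ^ (b * K) > 2]. *)
  exists bool, (fun _ _ => false); split=> //; first by rewrite card_bool.
  move=> d S hS; exfalso.
  have := leq_trans hS (max_card _); rewrite card_bool muln1 leqNgt -[X in X < _]expn1.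
  by rewrite ltn_exp2l //; nia.
have KiL : K ^ i <= L by apply: leq_trans KL; rewrite leq_pexp2l.
have [T [e [es ei cT Re]]] := IH KiL.
move: Re; set l := b * K * (3 * k) ^ i => Re.
have [e' [es' ei' Rc Rm]] : exists e' : rel T,
    [/\ symmetric e', irreflexive e', ramsey e' c 2 & ramsey e' (2 ^ l * c) r].
  apply: (exists_perturb e _ r L) => //; last by rewrite expn_gt0.
  by rewrite cT leq_exp2l.
have c2 : 2 <= c by rewrite cE leq_addl.
have m1 : 1 < 2 ^ l * c by rewrite (leq_trans c2) // leq_pmull ?expn_gt0.
have [T' [e2 [es2 ei2 cT2 R2]]] := lexpow e' c _ r K es' ei' (ltnW c2) m1 Rc Rm.
exists T', e2; split=> //; first by rewrite cT2 cT -expnM -expnSr.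
have := R2 k; rewrite (minn_idPl rk); apply: ramsey_weaken.
have mono_exp x y n : x <= y -> x ^ n <= y ^ n by case: n => // n; rewrite leq_exp2r.
have cb' : c <= 2 ^ b by apply: leq_trans cb; rewrite leq_pmull.
apply: (@leq_trans (2 ^ ((l + b) * k + b * K))).
  rewrite expnD (expnM 2 (l + b)) (expnM 2 b); apply: leq_mul; apply: mono_exp => //.
  by rewrite expnD leq_mul2l cb' orbT.
rewrite leq_exp2l // expnS mulnCA -/l.
have : b * K <= l by rewrite leq_pmulr // expn_gt0 muln_gt0 k0.
nia.
Qed.

(** The iteration's [b * K * (3 * k) ^ i] at [b = 3 * z ^ 2 + 5], [K = 2 ^ z], [k = z ^ 2],
    [i = z]. *)
Definition ramsey_exponent (z : nat) : nat :=
  (3 * z ^ 2 + 5) * 2 ^ z * (3 * z ^ 2) ^ z.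

Lemma exists_ramsey (z : nat) : 0 < z ->
  exists (T : finType) (e : rel T), [/\ symmetric e, irreflexive e,
    #|T| = 2 ^ (2 ^ z ^ 2) & ramsey e (2 ^ ramsey_exponent z) (2 ^ z ^ 2)].
Proof.
move=> z0; have k0 : 0 < z ^ 2 by rewrite expn_gt0 z0.
have Kz : (2 ^ z) ^ z = 2 ^ z ^ 2 by rewrite -expnM.
have := iterate_perturb_lexpow (2 ^ z ^ 2) (2 ^ z ^ 2) _ (3 * z ^ 2 + 5) (z ^ 2) (2 ^ z) z erefl.
rewrite Kz; apply=> //.
(* Here [L = r = x] with [x = 2 ^ z ^ 2], and [2 * c = 8 * (x + 3) * x ^ 2 + 4 <= 32 * x ^ 3 = 2 ^
   b] once [x >= 2]. *)
- rewrite expnD [3 * _]mulnC expnM.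
  have : 2 <= 2 ^ z ^ 2 by rewrite -[X in X <= _]expn1 leq_exp2l.
  by set x := 2 ^ z ^ 2; rewrite (_ : 2 ^ 5 = 32) // !expnS !expn0; nia.
- by rewrite expn_gt0.
- by rewrite expn_gt0.
Qed.

(** * Restriction to exactly [n] vertices, and small cases *)

Lemma ramsey_induced {T T' : finType} (e : rel T) (h : T' -> T) (m r : nat) :
  injective h -> ramsey e m r -> ramsey (fun x y => e (h x) (h y)) m r.
Proof.
move=> hI Re b S mS.
have [K KS /andP[/monoP mK rK]] : exists2 K : {set T}, K \subset h @: S &
    mono e b K && (r <= #|K|) by apply: Re; rewrite card_imset.
have KE : h @: (h @^-1: K) = K.
  apply/setP => y; apply/imsetP/idP => [[x]|yK]; first by rewrite inE => ? ->.
  by have /imsetP[x _ yE] := subsetP KS y yK; exists x; rewrite // inE -yE.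
exists (h @^-1: K).
  by apply/subsetP => x; rewrite inE => /(subsetP KS); rewrite mem_imset.
rewrite -(card_imset _ hI) KE rK andbT; apply/monoP => x y; rewrite !inE => xK yK xy.
by apply: mK => //; rewrite (inj_eq hI).
Qed.

Lemma exists_ramsey_ord (n z : nat) : 0 < z -> n <= 2 ^ (2 ^ z ^ 2) ->
  exists e : rel 'I_n, [/\ symmetric e, irreflexive e &
    ramsey e (2 ^ ramsey_exponent z) (2 ^ z ^ 2)].
Proof.
move=> z0; have [T [e [es ei cT Re]]] := exists_ramsey z z0; rewrite -cT => nT.
pose h (i : 'I_n) := enum_val (widen_ord nT i).
have hI : injective h by move=> i j /enum_val_inj/(congr1 val)/= /val_inj.
exists (fun x y => e (h x) (h y)); split=> //; last exact: ramsey_induced.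
Qed.

Lemma ramsey_1_1 {T : finType} (e : rel T) : ramsey e 1 1.
Proof.
move=> b S /card_gt0P[v vS]; exists [set v]; first by rewrite sub1set.
by rewrite cards1 andbT; apply/monoP => u w; rewrite !inE => /eqP-> /eqP->; rewrite eqxx.
Qed.

(** Settles [n = 4], where log log n = 1 makes the bound equal to 4 whatever the exponent is. *)
Lemma single_edge_ramsey :
  ramsey (fun x y : 'I_4 => (x != y) && (x < 2) && (y < 2)) 4 2.
Proof.
move=> b S; rewrite -[X in (X <= _)](card_ord 4) => hS.
have -> : S = [set: 'I_4].
  by apply/eqP; rewrite eqEcard subsetT cardsT.
pose o (i : nat) : 'I_4 := inord i.
exists [set o 0; if b then o 1 else o 3]; first exact: subsetT.
rewrite cards2; apply/andP; split; last by case: b; rewrite -val_eqE /= !inordK.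
apply/monoP => x y; rewrite !inE => /orP[]/eqP-> /orP[]/eqP->; rewrite ?eqxx //.
all: by case: b; rewrite -!val_eqE /= !inordK.
Qed.

Lemma ramsey_exponent_ge (z : nat) : 0 < z -> 2 ^ z <= ramsey_exponent z.
Proof.
move=> z0; rewrite /ramsey_exponent mulnAC leq_pmull // muln_gt0 addn_gt0 orbT.
by rewrite expn_gt0 muln_gt0 expn_gt0 z0.
Qed.

Lemma ramsey_exponent_le (z : nat) : 0 < z -> ramsey_exponent z <= (8 * z ^ 2) ^ z.+1.
Proof.
move=> z0; rewrite /ramsey_exponent [(8 * _) ^ _]expnS -mulnA; apply: leq_mul.
  by rewrite -mulnn; nia.
by rewrite -expnMn leq_exp2r // mulnA leq_mul2r orbT.
Qed.

End FiniteGraphs.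

Import Order.TTheory GRing.Theory Num.Theory.
Local Open Scope classical_set_scope.
Local Open Scope ring_scope.

(** * From [ramsey] to [mG] *)

Lemma mG_le (R : realType) (n : nat) (e : rel 'I_n) (m : nat) (r : R) :
  locally_ramsey e m%:R r -> (mG e r <= m)%N.
Proof. by move=> h; rewrite /mG; case: ex_minnP => k _; apply. Qed.

Lemma ramsey_locally_ramsey (R : realType) (n : nat) (e : rel 'I_n) (m r : nat) (x : R) :
  x <= r%:R -> ramsey e m r -> locally_ramsey e m%:R x.
Proof.
move=> xr Re; apply/forallP => S; apply/implyP; rewrite ler_nat => mS.
apply/andP; split.
  have [K KS /andP[/monoP mK rK]] := Re true S mS.
  apply/existsP; exists K; rewrite KS (le_trans xr) ?ler_nat // andbT.
  apply/forall_inP => u uK; apply/forall_inP => v vK; apply/implyP => uv.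
  by rewrite mK.
have [K KS /andP[/monoP mK rK]] := Re false S mS.
apply/existsP; exists K; rewrite KS (le_trans xr) ?ler_nat // andbT.
apply/forall_inP => u uK; apply/forall_inP => v vK; apply/implyP => uv.
by rewrite mK.
Qed.

(** * Binary logarithms and the error term *)

Section Log.
Variable R : realType.
Implicit Types x y : R.

Let ln2_gt0 : 0 < ln 2 :> R.
Proof. by rewrite ln_gt0 // ltr1n. Qed.

Lemma ln2_ge : 2^-1 <= ln 2 :> R.
Proof.
have := @le_ln1Dx R (- 2^-1).
rewrite (_ : 1 + - 2^-1 = 2^-1); last by field.
rewrite lnV ?posrE //; lra.
Qed.

Lemma powR_ln_div (a x : R) : 0 < a -> a != 1 -> 0 < x -> a `^ (ln x / ln a) = x.
Proof.
move=> a0 a1 x0; rewrite /powR gt_eqF // divfK ?lnK ?posrE //.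
by rewrite ln_eq0.
Qed.

Lemma ler_log2 x y : 0 < x -> x <= y -> log2 x <= log2 y.
Proof.
move=> x0 xy; rewrite /log2 ler_pM2r ?invr_gt0 // ler_ln ?posrE //.
exact: lt_le_trans xy.
Qed.

Lemma ltr_log2 x y : 0 < x -> x < y -> log2 x < log2 y.
Proof.
move=> x0 xy; rewrite /log2 ltr_pM2r ?invr_gt0 // ltr_ln ?posrE //.
exact: lt_trans xy.
Qed.

Lemma log2_exp2 (n : nat) : log2 (2 ^+ n) = n%:R :> R.
Proof. by rewrite /log2 lnXn // -[ln 2 *+ n]mulr_natl mulfK // gt_eqF. Qed.

Lemma log2_2 : log2 2 = 1 :> R.
Proof. by rewrite /log2 divff // gt_eqF. Qed.

Lemma log2_ge x y : expR (ln 2 * y) <= x -> y <= log2 x.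
Proof.
move=> h; rewrite /log2 ler_pdivlMr // mulrC -[leLHS]expRK ler_ln ?posrE ?expR_gt0 //.
exact: lt_le_trans (expR_gt0 _) h.
Qed.

Lemma loglog2_cvg (M : R) : \forall n \near \oo, M <= ln (log2 (log2 (n%:R : R))).
Proof.
have := nbhs_infty_ger (expR (ln 2 * expR (ln 2 * expR M))); apply: filterS => n hn.
have h := log2_ge _ _ (log2_ge _ _ hn).
rewrite -[leLHS]expRK ler_ln ?posrE ?expR_gt0 //.
exact: lt_le_trans (expR_gt0 _) h.
Qed.

(** Here [t] stands for log log n. With [s = sqrt t], [u = ln t] and [A] the logarithm of the
    exponent, [s <= A <= 12 * s * u] and [ln s = u / 2], so [ln A / u] exceeds 1/2 by at most (ln 12
    + ln u)/u = O(1/sqrt u). *)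
Lemma log2_ramsey_exponent_bound (z : nat) (t : R) : (0 < z)%N ->
  t <= z%:R ^+ 2 -> z%:R <= Num.sqrt t + 1 -> 5 <= ln t ->
  0 <= ln (log2 (ramsey_exponent z)%:R) / ln t - 2^-1 <= 14 / Num.sqrt (ln t).
Proof.
move=> z0 tz zt t5.
have t1 : 1 < t by rewrite ltNge; apply/negP => /ln_le0; lra.
set s := Num.sqrt t in zt *.
have s1 : 1 <= s by rewrite -[1]sqrtr1 ler_wsqrtr // ltW.
have s0 : 0 < s by lra.
have st : s ^+ 2 = t by rewrite sqr_sqrtr //; lra.
have lns : ln t = ln s *+ 2 by rewrite -st lnXn.
set E := ramsey_exponent z.
have zA : z%:R <= log2 E%:R :> R.
  by rewrite -log2_exp2 -natrX ler_log2 ?ltr0n ?expn_gt0 // ler_nat ramsey_exponent_ge.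
have z1 : 1 <= z%:R :> R by rewrite ler1n.
have sz : s <= z%:R by rewrite -(ler_pXn2r (_ : (0 < 2)%N)) ?nnegrE ?st //; lra.
set A := log2 E%:R in zA *.
have A0 : 0 < A by lra.
set u := ln t in t5 lns *.
have u0 : 0 < u by lra.
have lnsA : ln s <= ln A by rewrite ler_ln ?posrE //; lra.
apply/andP; split.
  rewrite subr_ge0 ler_pdivlMr //; move: lns; rewrite mulr2n; lra.
have hE : ln (E%:R : R) <= (z%:R + 1) * ln (8 * z%:R ^+ 2).
  rewrite natr1 mulr_natl -lnXn; last by rewrite mulr_gt0 ?exprn_gt0 //; lra.
  have E0 : 0 < E%:R :> R.
    by rewrite ltr0n; apply: leq_trans (ramsey_exponent_ge z z0); rewrite expn_gt0.
  rewrite ler_ln ?posrE ?exprn_gt0 ?mulr_gt0 ?exprn_gt0 ?ltr0n ?z0 //; last by rewrite -(ltr0n R).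
  by rewrite -natrX -natrM -natrX ler_nat ramsey_exponent_le.
(* From [z <= s + 1 <= 2 * s] comes [8 * z ^ 2 <= 32 * t]; then [5 <= ln t] absorbs [ln 32]. *)
have h8 : ln (8 * z%:R ^+ 2) <= 2 * u.
  apply: (@le_trans _ _ (ln (2 ^+ 5 * t))).
    rewrite ler_ln ?posrE ?mulr_gt0 ?exprn_gt0 //; try lra.
    rewrite -st; nra.
  rewrite lnM ?posrE ?exprn_gt0 //; last lra.
  rewrite lnXn // -/u.
  have : ln 2 <= 1 :> R by have := @le_ln1Dx R 1; rewrite -[1 + 1]/(2 : R); lra.
  rewrite -mulr_natl; lra.
(* [z + 1 <= 3 * s], and dividing by [ln 2 >= 1/2] at most doubles [6 * s * u]. *)
have hA : A <= 12 * s * u.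
  rewrite /A /log2 ler_pdivrMr //; apply: le_trans hE _.
  apply: (@le_trans _ _ (3 * s * (2 * u))).
    apply: ler_pM => //; try lra.
    apply: ln_ge0; nra.
  have := ln2_ge; have : 0 <= s * u by rewrite mulr_ge0 // ltW.
  nra.
have lnA : ln A <= 12 + ln s + 2 * Num.sqrt u.
  have s12 : 0 < 12 * s by lra.
  have : ln A <= ln (12 * s * u) by rewrite ler_ln ?posrE // mulr_gt0.
  have -> : ln (12 * s * u) = ln 12 + ln s + ln u by rewrite !lnM ?posrE.
  have : ln 12 < 12 :> R by apply: ln_sublinear.
  have : ln u <= 2 * Num.sqrt u.
    rewrite -[in leLHS](sqr_sqrtr (ltW u0)) lnXn ?sqrtr_gt0 // mulr2n.
    have : ln (Num.sqrt u) < Num.sqrt u by rewrite ln_sublinear // sqrtr_gt0.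
    lra.
  lra.
set w := Num.sqrt u in lnA *.
have w1 : 1 <= w by rewrite -[1]sqrtr1 ler_wsqrtr //; lra.
have wu : w ^+ 2 = u by rewrite sqr_sqrtr // ltW.
have w0 : 0 < w by lra.
(* As [w >= 1], [12 + 2 * w <= 14 * w], which is the source of 14. *)
rewrite lerBlDr ler_pdivrMr // mulrDl -[in X in _ <= X + _]wu.
rewrite (_ : 14 / w * w ^+ 2 = 14 * w); last by field; rewrite gt_eqF.
move: lns; rewrite mulr2n; lra.
Qed.

End Log.

(** * Choice of [z] for a given [n] *)

Lemma exists_tower_root (n : nat) : exists z : nat, (n <= 2 ^ (2 ^ z ^ 2))%N.
Proof.
exists n; have h k : (k <= 2 ^ k)%N by rewrite ltnW // ltn_expl.
apply: leq_trans (h n) _; rewrite leq_exp2l //; apply: leq_trans (h n) _.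
by rewrite leq_exp2l //; case: n {h} => // n; rewrite expnS leq_pmulr // expn_gt0.
Qed.

Definition tower_root (n : nat) : nat := ex_minn (exists_tower_root n).

Lemma tower_root_gt0 (n : nat) : (2 < n)%N -> (0 < tower_root n)%N.
Proof.
by move=> n2; rewrite /tower_root; case: ex_minnP => -[|z] // nz _; have := leq_trans n2 nz.
Qed.

Lemma tower_root_bounds (R : realType) (n : nat) : (2 < n)%N ->
  [/\ log2 (n%:R : R) <= (2 ^ tower_root n ^ 2)%:R,
    log2 (log2 (n%:R : R)) <= (tower_root n)%:R ^+ 2 &
    (tower_root n)%:R <= Num.sqrt (log2 (log2 (n%:R : R))) + 1].
Proof.
move=> n2; have n0 : 0 < n%:R :> R by rewrite ltr0n (ltn_trans _ n2).
have : 1 < log2 (n%:R : R).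
  by rewrite -[X in X < _](log2_2 R) ltr_log2 // ltr_nat.
set l := log2 n%:R => l1; have l0 : 0 < l by lra.
have := tower_root_gt0 n n2; rewrite /tower_root; case: ex_minnP => z nz zmin z0.
have lz : l <= (2 ^ z ^ 2)%:R by rewrite -(log2_exp2 R (2 ^ z ^ 2)) -natrX ler_log2 // ler_nat.
split=> //.
  by rewrite -natrX -(log2_exp2 R (z ^ 2)) ler_log2 // -natrX.
have zz : z%:R = z.-1%:R + 1 :> R by rewrite natr1 prednK.
rewrite zz lerD2r -[leLHS]ger0_norm // -sqrtr_sqr ler_wsqrtr // -natrX -(log2_exp2 R (z.-1 ^ 2)).
rewrite ler_log2 ?exprn_gt0 // -natrX -(log2_exp2 R (2 ^ z.-1 ^ 2)).
rewrite ler_log2 ?exprn_gt0 // -natrX ler_nat.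
(* By minimality of [z], its predecessor violates the defining inequality. *)
by rewrite leqNgt; apply/negP => /ltnW/zmin; rewrite leqNgt prednK // leqnn.
Qed.

(** * Convergence of the exponent, and the bound for every [n] *)

Lemma mG_small (R : realType) (n : nat) (e : rel 'I_n) (x : R) :
  x <= 1 -> (mG e x <= 1)%N.
Proof.
move=> x1; apply: mG_le; apply: (ramsey_locally_ramsey _ _ _ 1 1) => //; exact: ramsey_1_1.
Qed.

Theorem theorem1p1 (R : realType) :
  exists eps : nat -> R,
    eps n @[n --> \oo] --> 0 /\
    forall n : nat, exists e : rel 'I_n,
      [/\ symmetric e, irreflexive e &
        ((mG e (log2 (n%:R : R)))%:R : R) <=
          2 `^ (2 `^ ((log2 (log2 (n%:R : R))) `^ (2^-1 + eps n)))].
Proof.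
pose A n : R := log2 (ramsey_exponent (tower_root n))%:R.
pose lam n : R := log2 (log2 n%:R).
(* For [n > 2] this makes the bound exactly [2 ^ ramsey_exponent (tower_root n)], except
   at [n = 4], where [lam n = 1]. *)
exists (fun n => ln (A n) / ln (lam n) - 2^-1); split.
  apply/cvgr0Pnorm_le => d d0.
  have h3 : \forall n \near \oo, (2 < n)%N by exists 3%N.
  near=> n.
  have n2 : (2 < n)%N by near: n.
  (* 5 is the threshold of the error estimate, and [(14 / d) ^+ 2] brings that error below [d]. *)
  have M : Num.max 5 ((14 / d) ^+ 2) <= ln (lam n) by near: n; exact: loglog2_cvg.
  move: M; rewrite ge_max => /andP[M5 Md].
  have [_ b1 b2] := tower_root_bounds R n n2.
  have /andP[e0 e1] := log2_ramsey_exponent_bound R _ _ (tower_root_gt0 n n2) b1 b2 M5.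
  rewrite ger0_norm //; apply: le_trans e1 _.
  have s0 : 0 < Num.sqrt (ln (lam n)) by rewrite sqrtr_gt0; lra.
  rewrite ler_pdivrMr // -ler_pdivrMl // mulrC.
  rewrite -[leLHS]ger0_norm; last by rewrite divr_ge0 // ltW.
  by rewrite -sqrtr_sqr ler_wsqrtr.
(* For [n <= 2] the target size is at most 1 (with [ln 0 = 0]), and 2 to a nonnegative power is at
   least 1. *)
move=> n; have [n2|n2] := leqP n 2.
  exists (fun _ _ => false); split=> //.
  apply: (@le_trans _ _ 1).
    rewrite (ler_nat R _ 1); apply: mG_small.
    rewrite /log2 ler_pdivrMr ?mul1r; last by rewrite ln_gt0 // ltr1n.
    case: n n2 => [|n] n2; last by rewrite ler_ln ?posrE // ler_nat.
    by rewrite (le_trans (ln_le0 _)) // ln_ge0 // ler1n.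
  by rewrite -[leLHS](powRr0 2) ler_powR ?ler1n // powR_ge0.
have n0 : 0 < n%:R :> R by rewrite ltr0n (ltn_trans _ n2).
have l1 : 1 < log2 (n%:R : R).
  by rewrite -[X in X < _](log2_2 R) ltr_log2 // ltr_nat.
have [n4|n4] := eqVneq n 4%N.
  rewrite {}n4 in n2 n0 l1 *.
  exists (fun x y : 'I_4 => (x != y) && (x < 2)%N && (y < 2)%N); split.
  - by move=> x y; rewrite eq_sym andbAC.
  - by move=> x; rewrite eqxx.
  have -> : log2 4%:R = 2 :> R by rewrite -[RHS](log2_exp2 R 2) -natrX.
  have -> : log2 2 = 1 :> R by exact: log2_2.
  rewrite powR1 powRr1 // -[X in _ `^ X]/(2%:R) powR_mulrn // -natrX ler_nat.
  apply: mG_le; apply: (ramsey_locally_ramsey _ _ _ 4 2) => //; exact: single_edge_ramsey.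
have [b0 b1 b2] := tower_root_bounds R n n2.
have z0 := tower_root_gt0 n n2.
have nz : (n <= 2 ^ (2 ^ tower_root n ^ 2))%N.
  by rewrite /tower_root; case: ex_minnP.
have [e [es ei Re]] := exists_ramsey_ord n _ z0 nz.
exists e; split=> //.
have E2 : (2 <= ramsey_exponent (tower_root n))%N.
  apply: leq_trans (ramsey_exponent_ge _ z0); rewrite -[X in (X <= _)%N]expn1.
  by rewrite leq_exp2l.
have E0 : 0 < (ramsey_exponent (tower_root n))%:R :> R by rewrite ltr0n ltnW.
have A0 : 0 < A n.
  apply: (@lt_le_trans _ _ 1) => //.
  by rewrite -[X in X <= _](log2_2 R) ler_log2 // ler_nat.
have lam0 : 0 < lam n.
  by rewrite divr_gt0 ?ln_gt0 // ltr1n.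
(* The exponent divides by [ln (lam n)]; injectivity of [log2] shows that it vanishes only at
   [n = 4]. *)
have lam1 : lam n != 1.
  apply: contra n4 => /eqP.
  have inj (x y : R) : 0 < x -> 0 < y -> log2 x = log2 y -> x = y.
    move=> x0 y0 /(congr1 ( *%R^~ (ln 2))); rewrite /log2 !divfK ?gt_eqF ?ln_gt0 ?ltr1n //.
    by move/ln_inj; apply; rewrite posrE.
  rewrite -[X in _ = X](log2_2 R) => /inj => h.
  have {h} : log2 n%:R = 2%:R :> R by apply: h => //; lra.
  rewrite -(log2_exp2 R 2) => /inj; rewrite -natrX => h.
  by rewrite -(eqr_nat R) h // ltr0n.
rewrite addrC subrK powR_ln_div // powR_ln_div //; last by rewrite gt_eqF // ltr1n.
rewrite powR_mulrn // -natrX ler_nat; apply: mG_le.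
exact: ramsey_locally_ramsey b0 Re.
Unshelve. all: by end_near.
Qed.
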